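(* For every integer $k\ge 0$ there exists a finite, simple, connected, undirected graph $G$ such that $$\chi(G)\ \ge\ \mathrm{ind}(B(G))+2+k \qquad\text{and}\qquad \chi(G)\ \ge\ \mathrm{ind}(B_0(G))+1+k .$$
   Context: $\chi(G)$ denotes the chromatic number of $G$. Let $G$ be a graph with vertex set $V(G)$ and edge set $E(G)$. For $A\subseteq V(G)$ put $\mathrm{CN}(A)=\{v\in V(G): \{a,v\}\in E(G)\text{ for all }a\in A\}$ (so $\mathrm{CN}(\emptyset)=V(G)$). For disjoint $A,B\subseteq V(G)$, $G[A,B]$ is the graph with vertex set $A\cup B$ and edges $\{a,b\}\in E(G)$ with $a\in A$, $b\in B$; it is called complete bipartite if every $a\in A$ is adjacent to every $b\in B$ (vacuously true if $A$ or $B$ is empty). For sets $A,B$ write $A\uplus B=\{(a,0):a\in A\}\cup\{(b,1):b\in B\}$. The box complexes are the simplicial complexes $B(G)=\{A\uplus B: A,B\subseteq V(G),\ A\cap B=\emptyset,\ G[A,B]\text{ complete bipartite},\ \mathrm{CN}(A)\neq\emptyset\neq\mathrm{CN}(B)\}$ and $B_0(G)=\{A\uplus B: A,B\subseteq V(G),\ A\cap B=\emptyset,\ G[A,B]\text{ complete bipartite}\}$, both with the free $\mathbb{Z}_2$-action $A\uplus B\mapsto B\uplus A$. Complexes are identified with their geometric realizations. A $\mathbb{Z}_2$-space is a pair $(X,\nu)$ with $\nu:X\to X$ a homeomorphism with $\nu^2=\mathrm{id}$; a $\mathbb{Z}_2$-map is a continuous map commuting with the involutions. The sphere $S^n$ carries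 the antipodal involution $x\mapsto -x$. The $\mathbb{Z}_2$-index of $X$ is $\mathrm{ind}(X)=\min\{n\ge 0:\text{there is a }\mathbb{Z}_2\text{-map }X\to S^n\}$. *)

(* Defs.v *)
From HB Require Import structures.
From mathcomp Require Import all_boot all_order all_algebra.
From mathcomp Require Import all_classical all_reals all_analysis.
Import Order.TTheory GRing.Theory Num.Theory.
Import numFieldNormedType.Exports.

Set Implicit Arguments.
Unset Strict Implicit.
Unset Printing Implicit Defensive.

Record sgraph := SGraph {
  vertex :> finType;
  adj : rel vertex;
  adj_sym : symmetric adj;
  adj_irrefl : irreflexive adj }.

Definition connected_graph (G : sgraph) : Prop :=
  (0 < #|G|)%N /\ forall x y : G, connect (@adj G) x y.

Definition colorable (G : sgraph) (k : nat) : bool :=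
  [exists c : {ffun G -> 'I_k},
    [forall x, forall y, adj x y ==> (c x != c y)]].

Lemma colorable_card (G : sgraph) : colorable G #|G|.
Proof.
apply/existsP; exists [ffun x => enum_rank x].
apply/forallP => x; apply/forallP => y; apply/implyP => xy.
rewrite !ffunE; apply/eqP => /enum_rank_inj exy.
by rewrite exy adj_irrefl in xy.
Qed.

Definition chromatic_number (G : sgraph) : nat :=
  ex_minn (ex_intro (colorable G) #|G| (colorable_card G)).

(* A continuous involution is automatically a homeomorphism. *)
Record z2space := Z2Space {
  space :> topologicalType;
  nu : space -> space;
  nu_continuous : continuous nu;
  nu_invol : involutive nu }.

Definition z2map (X Y : z2space) (f : X -> Y) : Prop :=
  continuous f /\ forall x, f (nu x) = nu (f x).

Lemma continuous_set_type (X Y : topologicalType) (A : set Y)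
    (f : X -> set_type A) :
  continuous (fun x => set_val (f x)) -> continuous f.
Proof.
move=> cf; apply/continuousP => _ [W oW <-].
by move/continuousP: cf => /(_ W oW).
Qed.

Lemma continuous_ptws (X Y : topologicalType) (I : Type)
    (f : X -> {ptws I -> Y}) :
  (forall i, continuous (fun x => f x i)) -> continuous f.
Proof.
move=> cf x; apply/cvg_sup => i; move: x.
apply/(@continuousP _ (initial_topology (fun g : I -> Y => g i))).
by move=> _ [W oW <-]; move/continuousP: (cf i) => /(_ W oW).
Qed.

Section Sphere.
Variables (R : realType) (n : nat).
Local Open Scope ring_scope.
Local Open Scope classical_set_scope.

(* The norm of 'rV[R]_n.+1 is the sup norm, hence the explicit sum of squares. *)
Definition unit_sphere : set 'rV[R]_n.+1 :=
  [set x : 'rV[R]_n.+1 | \sum_(i < n.+1) x ord0 i ^+ 2 = 1].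

Lemma unit_sphereN (x : set_type unit_sphere) : - set_val x \in unit_sphere.
Proof.
have := set_valP x; rewrite /unit_sphere inE /= => x1.
by rewrite -[RHS]x1; apply: eq_bigr => i _; rewrite mxE sqrrN.
Qed.

Definition antipode (x : set_type unit_sphere) : set_type unit_sphere :=
  exist _ (- set_val x) (unit_sphereN x).

Lemma antipode_continuous : continuous antipode.
Proof.
apply: continuous_set_type.
have -> : (fun x => set_val (antipode x)) = -%R \o set_val.
  by rewrite set_valE.
move=> x; apply: continuous_comp; first exact: initial_continuous.
exact: opp_continuous.
Qed.

Lemma antipodeK : involutive antipode.
Proof. by move=> x; apply: val_inj; rewrite /= opprK. Qed.

Definition sphere : z2space := Z2Space antipode_continuous antipodeK.

End Sphere.

(* n = min {n >= 0 : there is a Z2-map X -> S^n}; the relation holds for no n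
   when the set is empty. *)
Definition is_z2index (R : realType) (X : z2space) (n : nat) : Prop :=
  (exists f : X -> sphere R n, z2map f) /\
  (forall m, (exists f : X -> sphere R m, z2map f) -> (n <= m)%N).

(* The vertices of the complex are those v with [set v] a face; other elements
   of the ground set are not used. The empty set is allowed as a face. *)
Record z2complex := Z2Complex {
  ground : finType;
  faces : {set {set ground}};
  faces_down : forall s t : {set ground},
    s \in faces -> t \subset s -> t \in faces;
  flip : ground -> ground;
  flip_invol : involutive flip;
  flip_faces : forall s, s \in faces -> (flip @: s)%SET \in faces }.

Section Realization.
Variables (R : realType) (K : z2complex).
Local Open Scope ring_scope.
Local Open Scope classical_set_scope.

(* Barycentric coordinates: the ground set being finite, the topology of the
   realization is the one induced by R^ground. *)
Definition realization_set : set {ptws ground K -> R} :=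
  [set w : {ptws ground K -> R} |
    [/\ forall v, 0 <= w v, \sum_v w v = 1 &
        [set v | w v != 0]%SET \in faces K]].

(* The affine extension of flip sends w to w \o flip^-1, and flip is its own
   inverse. *)
Definition flip_coords (w : {ptws ground K -> R}) : {ptws ground K -> R} :=
  fun v => w (flip v).

Lemma realization_flip (w : set_type realization_set) :
  flip_coords (set_val w) \in realization_set.
Proof.
have := set_valP w; rewrite /realization_set inE /= => -[w0 w1 wK]; split.
- by move=> v; exact: w0.
- rewrite -[RHS]w1 [RHS](reindex_inj (inv_inj (@flip_invol K))) /=.
  by apply: eq_bigr.
- suff -> : [set v | set_val w (flip v) != 0]%SET =
            (@flip K @: [set v | set_val w v != 0])%SET by exact: flip_faces.
  apply/setP => v; rewrite -{2}[v](@flip_invol K).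
  by rewrite mem_imset ?inE//; exact: inv_inj (@flip_invol K).
Qed.

Definition realization_nu (w : set_type realization_set) :
    set_type realization_set :=
  exist _ (flip_coords (set_val w)) (realization_flip w).

Lemma realization_nu_continuous : continuous realization_nu.
Proof.
apply: continuous_set_type; apply: continuous_ptws => v w.
apply: (@continuous_comp _ _ _ set_val
  (fun g : {ptws ground K -> R} => g (flip v))).
  exact: initial_continuous.
exact: proj_continuous.
Qed.

Lemma realization_nuK : involutive realization_nu.
Proof.
move=> w; apply: val_inj; apply/funext => v /=.
by rewrite /flip_coords !set_valE /= /flip_coords flip_invol.
Qed.

Definition realization : z2space :=
  Z2Space realization_nu_continuous realization_nuK.

End Realization.

Section BoxComplexes.
Variable G : sgraph.
Implicit Types A B : {set G}.
Local Open Scope set_scope.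

Definition CN A : {set G} := [set v | [forall a in A, adj a v]].

Definition complete_bipartite A B : bool :=
  [forall a in A, forall b in B, adj a b].

(* A \uplus B; the copies 0 and 1 are tagged false and true. *)
Definition biplus A B : {set G * bool} :=
  [set (a, false) | a in A] :|: [set (b, true) | b in B].

Definition box0_cond A B : bool := [disjoint A & B] && complete_bipartite A B.

Definition box_cond A B : bool :=
  [&& box0_cond A B, CN A != finset.set0 & CN B != finset.set0].

Definition box0_faces : {set {set G * bool}} :=
  [set biplus A B | A in {set G}, B in {set G} & box0_cond A B].

Definition box_faces : {set {set G * bool}} :=
  [set biplus A B | A in {set G}, B in {set G} & box_cond A B].

Definition swap_copy (v : G * bool) : G * bool := (v.1, ~~ v.2).

Lemma swap_copyK : involutive swap_copy.
Proof. by case=> a b; rewrite /swap_copy /= negbK. Qed.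

Lemma mem_biplus A B v : (v \in biplus A B) = (v.1 \in if v.2 then B else A).
Proof.
case: v => a b; rewrite inE; apply/orP/idP => /=.
  by case=> /imsetP[x xA [-> ->]].
by case: b => aA; [right | left]; apply/imsetP; exists a.
Qed.

Lemma swap_biplus A B : swap_copy @: biplus A B = biplus B A.
Proof.
apply/setP => v; rewrite -[v in LHS]swap_copyK mem_imset; last first.
  exact: inv_inj swap_copyK.
by rewrite !mem_biplus /=; case: v.2.
Qed.

Lemma sub_biplus A B (t : {set G * bool}) : t \subset biplus A B ->
  exists A' B', [/\ t = biplus A' B', A' \subset A & B' \subset B].
Proof.
move=> /fintype.subsetP tAB.
exists [set a | (a, false) \in t], [set b | (b, true) \in t]; split.
- by apply/setP => -[a b]; rewrite mem_biplus /=; case: b; rewrite inE.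
- by apply/fintype.subsetP => a; rewrite inE => /tAB; rewrite mem_biplus.
- by apply/fintype.subsetP => a; rewrite inE => /tAB; rewrite mem_biplus.
Qed.

Lemma CN_anti A A' : A' \subset A -> CN A != finset.set0 -> CN A' != finset.set0.
Proof.
move=> /fintype.subsetP sA /finset.set0Pn[v]; rewrite inE => /forall_inP Av.
by apply/finset.set0Pn; exists v; rewrite inE; apply/forall_inP => a /sA /Av.
Qed.

Lemma box0_cond_sub A B A' B' :
  A' \subset A -> B' \subset B -> box0_cond A B -> box0_cond A' B'.
Proof.
move=> sA sB /andP[dAB /forall_inP cAB]; apply/andP; split.
  exact: disjointWl sA (disjointWr sB dAB).
apply/forall_inP => a /(fintype.subsetP sA) /cAB /forall_inP aB.
by apply/forall_inP => b /(fintype.subsetP sB) /aB.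
Qed.

Lemma box0_condC A B : box0_cond A B -> box0_cond B A.
Proof.
move=> /andP[dAB /forall_inP cAB]; rewrite /box0_cond disjoint_sym dAB /=.
apply/forall_inP => b bB; apply/forall_inP => a aA.
by rewrite adj_sym; exact: (forall_inP (cAB a aA)).
Qed.

Lemma box_cond_sub A B A' B' :
  A' \subset A -> B' \subset B -> box_cond A B -> box_cond A' B'.
Proof.
move=> sA sB /and3P[cAB nA nB].
by rewrite /box_cond (box0_cond_sub sA sB cAB) (CN_anti sA nA) (CN_anti sB nB).
Qed.

Lemma box_condC A B : box_cond A B -> box_cond B A.
Proof. by move=> /and3P[cAB nA nB]; rewrite /box_cond box0_condC ?nA ?nB. Qed.

Lemma box0_faces_down (s t : {set G * bool}) :
  s \in box0_faces -> t \subset s -> t \in box0_faces.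
Proof.
move=> /imset2P[A B _]; rewrite inE => cAB ->.
move=> /sub_biplus[A' [B' [-> sA sB]]]; apply/imset2P.
by exists A' B' => //; rewrite inE; exact: box0_cond_sub cAB.
Qed.

Lemma box_faces_down (s t : {set G * bool}) :
  s \in box_faces -> t \subset s -> t \in box_faces.
Proof.
move=> /imset2P[A B _]; rewrite inE => cAB ->.
move=> /sub_biplus[A' [B' [-> sA sB]]]; apply/imset2P.
by exists A' B' => //; rewrite inE; exact: box_cond_sub cAB.
Qed.

Lemma box0_faces_swap (s : {set G * bool}) :
  s \in box0_faces -> swap_copy @: s \in box0_faces.
Proof.
move=> /imset2P[A B _]; rewrite inE => cAB ->; rewrite swap_biplus.
by apply/imset2P; exists B A => //; rewrite inE; exact: box0_condC.
Qed.

Lemma box_faces_swap (s : {set G * bool}) :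
  s \in box_faces -> swap_copy @: s \in box_faces.
Proof.
move=> /imset2P[A B _]; rewrite inE => cAB ->; rewrite swap_biplus.
by apply/imset2P; exists B A => //; rewrite inE; exact: box_condC.
Qed.

Definition box_complex0 : z2complex :=
  Z2Complex box0_faces_down swap_copyK box0_faces_swap.

Definition box_complex : z2complex :=
  Z2Complex box_faces_down swap_copyK box_faces_swap.

End BoxComplexes.

(* Main.v *)
Require Import Defs.
From mathcomp Require Import all_boot all_order all_algebra.
From mathcomp Require Import all_classical all_reals all_analysis.
Import Order.TTheory GRing.Theory Num.Theory numFieldNormedType.Exports.

Set Implicit Arguments.
Unset Strict Implicit.
Unset Printing Implicit Defensive.

(** If G has no 4-cycle, both box complexes map equivariantly to S^2, however
    large the chromatic number of G is; so it is enough to have connected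
    C4-free graphs of arbitrarily large chromatic number.

    The map to S^2 ([box0_power_sums_neq0]).  Give a point w of B_0(G) its two
    restrictions u0 and u1 to the copies of the vertex set, and consider the
    three differences
      sum u0 - sum u1,   sum u0^2 - sum u1^2,   sum r u0 - sum r u1
    where r numbers the vertices injectively.  They are continuous and odd, so
    after normalization they give a map to S^2 as soon as they have no common
    zero.  If the first one vanishes, both sums are 1/2, hence both sides A, B
    of the supporting face are nonempty; as a C4-free graph contains no
    K_{2,2}, one of A, B is a single vertex.  The corresponding sum of squares
    is then the largest possible, 1/4, so if the second difference vanishes the
    other side is a single vertex too.  Then w is the midpoint of an edge
    ({a}, {b}), and the third difference is (r a - r b)/2, which is nonzero
    because A and B are disjoint.  Since B(G) is a subcomplex of B_0(G), the
    same map serves for both.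

    The graphs.  Blanche Descartes' construction ([descartes]) makes a graph G
    that is not k-colourable into one that is not (k+1)-colourable, and creates
    no 4-cycle: add an independent set Y so large that every colouring with k+1
    colours is constant on some #|G| points of Y, and match every injective
    image of G in Y with its own copy of G; in the copy matched with a
    monochromatic image, one colour is lost.  Joining a new vertex to all
    others by paths of length 2 ([subdivided_cone]) makes the result connected
    and again creates no 4-cycle. *)

(** * Colourings *)

Lemma colorableP (G : sgraph) k :
  reflect (exists c : G -> 'I_k, forall x y, adj x y -> c x != c y)
          (colorable G k).
Proof.
apply: (iffP existsP) => -[c cG].
  by exists c => x y xy; move/forallP/(_ x)/forallP/(_ y)/implyP: cG; apply.
exists [ffun x => c x]; apply/forallP => x; apply/forallP => y.
by rewrite !ffunE; apply/implyP; exact: cG.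
Qed.

Lemma colorable_hom (G H : sgraph) (h : G -> H) k :
  (forall x y, adj x y -> adj (h x) (h y)) -> colorable H k -> colorable G k.
Proof.
move=> hG /colorableP[c cH]; apply/colorableP.
by exists (c \o h) => x y /hG /cH.
Qed.

Lemma colorable_leq (G : sgraph) k m :
  k <= m -> colorable G k -> colorable G m.
Proof.
move=> km /colorableP[c cG]; apply/colorableP.
by exists (widen_ord km \o c) => x y /cG.
Qed.

Lemma ltn_chromatic_number (G : sgraph) k :
  ~~ colorable G k -> k < chromatic_number G.
Proof.
rewrite /chromatic_number; case: ex_minnP => m mG _.
by rewrite ltnNge; apply: contraNN => mk; exact: colorable_leq mG.
Qed.

Lemma pigeonhole (T : finType) k n (c : T -> 'I_k.+1) :
  k.+1 * n <= #|T| -> exists i, n <= #|[pred y | c y == i]|.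
Proof.
case: n => [|n] leT; first by exists ord0.
apply/existsP; apply: contraT; rewrite negb_exists => /forallP small.
suff : #|T| <= k.+1 * n by rewrite leqNgt (leq_trans _ leT) // ltn_pmul2l.
rewrite -sum1_card (partition_big c predT) //=.
rewrite -[k.+1 in X in _ <= X]card_ord -sum_nat_const.
by apply: leq_sum => i _; rewrite sum1_card -ltnS ltnNge small.
Qed.

(** * C4-free graphs of large chromatic number *)

(** A 4-cycle is u, x, v, y with u and v, and also x and y, distinct. *)
Definition C4_free (G : sgraph) : Prop :=
  forall u v x y : G, u != v -> adj u x -> adj v x -> adj u y -> adj v y ->
  x = y.

Section DescartesStep.
Variables (G : sgraph) (k : nat).

(** The number of points is the one that the pigeonhole principle needs for
    k.+1 colours. *)
Let Y := 'I_(k.+1 * #|G|).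

(** The pair (f, v) is the vertex v of the copy of G matched with the image of
    f; a copy indexed by a map that is not injective is left isolated from Y,
    since matching it could create 4-cycles. *)
Definition descartes_adj : rel (Y + {ffun G -> Y} * G) := fun x y =>
  match x, y with
  | inl _, inl _ => false
  | inl i, inr (f, v) | inr (f, v), inl i => injectiveb f && (f v == i)
  | inr (f, v), inr (g, w) => (f == g) && adj v w
  end.

Lemma descartes_adj_sym : symmetric descartes_adj.
Proof.
by case=> [i|[f v]] [j|[g w]] //=; rewrite eq_sym adj_sym.
Qed.

Lemma descartes_adj_irrefl : irreflexive descartes_adj.
Proof. by case=> [i|[f v]] //=; rewrite adj_irrefl andbF. Qed.

Definition descartes : sgraph :=
  SGraph descartes_adj_sym descartes_adj_irrefl.

(** A point of Y has at most one neighbour in each copy, a vertex of a copy has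
    exactly one neighbour in Y if any, and distinct copies are not adjacent; so
    a 4-cycle would have to stay inside one copy. *)
Lemma descartes_C4_free : C4_free G -> C4_free descartes.
Proof.
move=> G4 [i|[f u]] [j|[g v]] [a|[p x]] [b|[q y]] //= uv.
(* The first three cases have u or v in Y, the last four neither; these are
   split by which of x and y are in Y. *)
- move=> /andP[_ /eqP pi] /andP[_ /eqP pj].
  by rewrite -pi -pj eqxx in uv.
- move=> /andP[/injectiveP pI /eqP pi] /andP[/eqP gp _].
  move=> /andP[_ /eqP qi] /andP[/eqP gq _].
  by subst p q; rewrite -pi in qi; rewrite (pI _ _ qi).
- move=> /andP[/eqP fp _] /andP[/injectiveP pI /eqP pj].
  move=> /andP[/eqP fq _] /andP[_ /eqP qj].
  by subst p q; rewrite -pj in qj; rewrite (pI _ _ qj).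
- by move=> /andP[_ /eqP <-] _ /andP[_ /eqP ->].
- move=> /andP[/injectiveP fI /eqP fu] /andP[_ /eqP gv].
  move=> /andP[/eqP fq _] /andP[/eqP gq _].
  by move: fu uv; rewrite -gv gq -fq => /fI ->; rewrite eqxx.
- move=> /andP[/eqP fq _] /andP[/eqP gq _].
  move=> /andP[/injectiveP fI /eqP fu] /andP[_ /eqP gv].
  by move: fu uv; rewrite -gv gq -fq => /fI ->; rewrite eqxx.
- move=> /andP[/eqP fp ux] /andP[/eqP gp vx] /andP[/eqP fq uy] /andP[_ vy].
  move: uv; rewrite gp -fp -fq => uv; congr (inr (_, _)).
  by apply: (G4 u v) => //; apply: contraNneq uv => ->.
Qed.

(** Some colour i is used at #|G| points of Y; the copy of G matched with them
    avoids i, hence uses only k colours. *)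
Lemma descartes_not_colorable : ~~ colorable G k -> ~~ colorable descartes k.+1.
Proof.
apply: contraNN => /colorableP[c cD].
have [|i leGi] := @pigeonhole Y k #|G| (c \o inl); first by rewrite card_ord.
pose f := [ffun v : G => enum_val (widen_ord leGi (enum_rank v))].
have fI : injectiveb f.
  apply/injectiveP => u v; rewrite !ffunE => /enum_val_inj /(congr1 val) /=.
  by move=> /val_inj /enum_rank_inj.
have fi v : c (inl (f v)) = i.
  by rewrite ffunE; apply/eqP/(enum_valP (widen_ord leGi (enum_rank v))).
have /fin_all_exists[d cd] v : exists d, c (inr (f, v)) = lift i d.
  have /unlift_some[d cd _] : i != c (inr (f, v)).
    by rewrite -(fi v); apply: cD; rewrite /= fI eqxx.
  by exists d.
apply/colorableP; exists d => u v uv.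
have := cD (inr (f, u)) (inr (f, v)); rewrite /= eqxx !cd (inj_eq lift_inj).
exact.
Qed.

End DescartesStep.

Definition K1 : sgraph :=
  @SGraph unit (fun _ _ => false) (fun _ _ => erefl) (fun _ => erefl).

Lemma C4_free_not_colorable k :
  exists2 G : sgraph, C4_free G & ~~ colorable G k.
Proof.
elim: k => [|k [G G4 Gk]].
  by exists K1 => //; apply/colorableP => -[c _]; case: (c tt).
exists (descartes G k); first exact: descartes_C4_free.
exact: descartes_not_colorable.
Qed.

Section SubdividedCone.
Variable G : sgraph.

(** [None] is the apex, (v, false) the vertex v of G and (v, true) the middle of
    the path from v to the apex. *)
Definition cone_adj : rel (option (G * bool)) := fun x y =>
  match x, y with
  | None, Some (_, true) | Some (_, true), None => true
  | Some (u, false), Some (v, false) => adj u v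
  | Some (u, false), Some (v, true) | Some (u, true), Some (v, false) => u == v
  | _, _ => false
  end.

Lemma cone_adj_sym : symmetric cone_adj.
Proof. by case=> [[u []]|] [[v []]|] //=; rewrite 1?eq_sym 1?adj_sym. Qed.

Lemma cone_adj_irrefl : irreflexive cone_adj.
Proof. by case=> [[u []]|] //=; exact: adj_irrefl. Qed.

Definition subdivided_cone : sgraph := SGraph cone_adj_sym cone_adj_irrefl.

(** A cycle through the apex contains two new paths, hence has length at
    least 5. *)
Lemma subdivided_cone_C4_free : C4_free G -> C4_free subdivided_cone.
Proof.
move=> G4 [[u []]|] [[v []]|] [[x []]|] [[y []]|] //= uv ux vx uy vy.
all: repeat match goal with
  H : is_true (_ == _) |- _ => move/eqP: H => H; subst end.
all: rewrite ?eqxx in uv => //.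
all: try by move: ux uy vx vy; rewrite ?adj_irrefl.
  congr (Some (_, _)).
  by apply: (G4 u v) => //; apply: contraNneq uv => ->.
Qed.

Lemma subdivided_cone_connected : connected_graph subdivided_cone.
Proof.
split=> [|x y]; first by apply/card_gt0P; exists None.
have apex z : connect (@adj subdivided_cone) z None.
  case: z => [[v b]|] //.
  apply: (@connect_trans _ _ (Some (v, true))); last exact: connect1.
  by case: b => //; apply: connect1; exact: eqxx.
apply: (connect_trans (apex x)).
by rewrite (sym_connect_sym (@adj_sym subdivided_cone)).
Qed.

Lemma subdivided_cone_not_colorable k :
  ~~ colorable G k -> ~~ colorable subdivided_cone k.
Proof.
exact/contraNN/(@colorable_hom G subdivided_cone (fun v => Some (v, false))).
Qed.

End SubdividedCone.

(** * Equivariant maps to spheres *)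

Section SphereMaps.
Local Open Scope ring_scope.
Local Open Scope classical_set_scope.

Lemma is_z2index_exists (R : realType) (X : z2space) n :
  (exists f : X -> sphere R n, z2map f) ->
  exists2 i, is_z2index R X i & (i <= n)%N.
Proof.
move=> fn; pose P m := `[< exists f : X -> sphere R m, z2map f >].
have exP : exists m, P m by exists n; apply/asboolP.
case: (ex_minnP exP) => i /asboolP fi imin; exists i.
  by split=> // m fm; apply: imin; apply/asboolP.
by apply: imin; apply/asboolP.
Qed.

Lemma continuous_mx (X T : topologicalType) m n (f : X -> 'M[T]_(m, n)) :
  (forall i j, continuous (fun x => f x i j)) -> continuous f.
Proof.
move=> cf x A [P nP PA].
have fP : \forall y \near x,
    forall ij : 'I_m * 'I_n, P ij.1 ij.2 (f y ij.1 ij.2).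
  by apply: filter_forall => ij; exact: cf (nP _ _).
by apply: filterS fP => y fP; apply: PA => i j; exact: (fP (i, j)).
Qed.

(** The map is x |-> g x / |g x|, for the Euclidean norm. *)
Lemma sphere_map_of_odd (R : realType) (X : z2space) n
    (g : 'I_n.+1 -> X -> R) :
    (forall i, continuous (g i)) -> (forall i x, g i (nu x) = - g i x) ->
    (forall x, exists i, g i x != 0) ->
  exists f : X -> sphere R n, z2map f.
Proof.
move=> gc gN gn0; pose r x := Num.sqrt (\sum_i g i x ^+ 2).
have s_gt0 x : 0 < \sum_i g i x ^+ 2.
  have [i gi] := gn0 x; rewrite (bigD1 i) //= ltr_pwDl ?exprn_even_gt0 //.
  by apply: sumr_ge0 => j _; exact: sqr_ge0.
have r_gt0 x : 0 < r x by rewrite sqrtr_gt0.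
have r_nu x : r (nu x) = r x.
  by congr Num.sqrt; apply: eq_bigr => i _; rewrite gN sqrrN.
have r_cont : continuous r.
  move=> x; apply: (@continuous_comp _ _ _ (fun x => \sum_i g i x ^+ 2)
    (@Num.sqrt R)); last exact: sqrt_continuous.
  move: x; apply: continuous_big => [|i _ x]; first exact: add_continuous.
  apply: (@continuous_comp _ _ _ (g i) (fun y => y ^+ 2)); first exact: gc.
  exact: exprn_continuous.
pose f x : 'rV[R]_n.+1 := \row_i (g i x / r x).
have fS x : f x \in @unit_sphere R n.
  rewrite inE /unit_sphere /=.
  under eq_bigr do rewrite mxE expr_div_n.
  rewrite -mulr_suml /r sqr_sqrtr ?ltW // divff // gt_eqF //.
exists (fun x => exist _ (f x) (fS x)); split; last first.
  move=> x; apply: val_inj; apply/rowP => i /=.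
  by rewrite !mxE r_nu gN mulNr.
apply: continuous_set_type; rewrite set_valE /=; apply: continuous_mx => i j.
rewrite (_ : (fun _ => _) = fun x => g j x / r x); last first.
  by apply/funext => x; rewrite mxE.
move=> x; apply: cvgM; first exact: gc.
by apply: cvgV; [rewrite gt_eqF | exact: r_cont].
Qed.

Lemma continuous_power_sum (R : realType) (X : topologicalType) (T : finType)
    (a : T -> R) (h : T -> X -> R) p :
  (forall v, continuous (h v)) -> continuous (fun x => \sum_v a v * h v x ^+ p).
Proof.
move=> hc; apply: continuous_big => [|v _ x]; first exact: add_continuous.
apply: cvgM; first exact: cvg_cst.
apply: (@continuous_comp _ _ _ (h v) (fun y => y ^+ p)); first exact: hc.
exact: exprn_continuous.
Qed.

(** Weighted power sums of the barycentric coordinates are continuous, and odd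
    when the weights are. *)
Lemma power_sums_z2map (R : realType) (K : z2complex) n
    (a : 'I_n.+1 -> ground K -> R) (p : 'I_n.+1 -> nat) :
    (forall i v, a i (flip v) = - a i v) ->
    (forall w, w \in @realization_set R K ->
      exists i, \sum_v a i v * w v ^+ p i != 0) ->
  exists f : realization R K -> sphere R n, z2map f.
Proof.
move=> aN an0.
pose h v (w : set_type (@realization_set R K)) : R := set_val w v.
apply: (@sphere_map_of_odd R (realization R K) n
  (fun i w => \sum_v a i v * h v w ^+ p i)); rewrite /h.
- move=> i; apply: (@continuous_power_sum R (realization R K)) => v w.
  apply: (@continuous_comp _ _ _ set_val
    (fun g : {ptws ground K -> R} => g v)).
    exact: initial_continuous.
  exact: proj_continuous.
- move=> i w; rewrite (reindex_inj (inv_inj (@flip_invol K))) /= -sumrN.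
  apply: eq_bigr => v _; rewrite aN mulNr.
  by rewrite !set_valE /= /flip_coords flip_invol.
- by move=> w; apply: an0; apply: mem_set; exact: set_valP.
Qed.

End SphereMaps.

(** * Functions concentrated at one point *)

Local Open Scope ring_scope.

Section Concentrated.
Variables (R : realDomainType) (T : finType) (u : T -> R).

Definition concentrated : Prop :=
  exists x0, forall x, u x = (\sum_x u x) *+ (x == x0).

Lemma concentrated_support :
  \sum_x u x != 0 -> {in [pred x | u x != 0] &, forall x y, x = y} ->
  concentrated.
Proof.
move=> sn0 one; have [x0 ux0] : exists x0, u x0 != 0.
  apply/existsP; apply: contraNT sn0; rewrite negb_exists => /forallP H.
  by apply/eqP/big1 => x _; apply/eqP; rewrite -[_ == _]negbK.
have uN x : x != x0 -> u x = 0.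
  by move=> xx0; apply/eqP; apply: contraNT xx0 => ux; apply/eqP/one.
exists x0 => x; case: eqVneq => [->|/uN -> //].
by rewrite mulr1n (bigD1 x0) //= big1 ?addr0.
Qed.

(** With s = sum u, the equality says that the sum of the u x * (s - u x) is 0;
    as these terms are nonnegative, u only takes the values 0 and s, and it
    takes the value s only once. *)
Lemma concentratedP : (forall x, 0 <= u x) -> \sum_x u x != 0 ->
  \sum_x u x ^+ 2 = (\sum_x u x) ^+ 2 <-> concentrated.
Proof.
move=> u0; set s := \sum_x u x => sn0; split=> [s2|[x0]]; last first.
  rewrite -/s => ux; rewrite (bigD1 x0) //= big1 => [|x /negPf xx0]; last first.
    by rewrite ux xx0 mulr0n expr0n.
  by rewrite ux eqxx mulr1n addr0.
have us x : u x <= s by rewrite /s (bigD1 x) //= lerDl sumr_ge0.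
have u_or x : u x != 0 -> u x = s.
  move=> ux; have u_s0 y : 0 <= u y * (s - u y) by rewrite mulr_ge0 ?subr_ge0.
  have /psumr_eq0P/(_ x isT)/eqP : \sum_x u x * (s - u x) = 0.
    under eq_bigr do rewrite mulrBr -expr2.
    by rewrite sumrB -mulr_suml s2 -expr2 subrr.
  rewrite mulf_eq0 subr_eq0 (negPf ux) /= => sux.
  by apply/esym/eqP/sux => y _; exact: u_s0.
apply: concentrated_support => // x y; rewrite !inE => ux uy.
apply: contraNeq ux => xy.
have /psumr_eq0P -> // : \sum_(z | z != y) u z = 0.
  by apply: (addrI (u y)); rewrite addr0 {2}(u_or y uy) /s [RHS](bigD1 y).
Qed.

End Concentrated.

(** * Box complexes of C4-free graphs *)

(** With these labels and the exponents below, the power sums over one copy are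
    the total mass, the sum of squares, and the first moment of the numbering of
    the vertices. *)
Definition box_label (R : realType) (G : sgraph) (i : 'I_3) (a : G) : R :=
  if i == 2 :> nat then (enum_rank a)%:R else 1.

Definition box_weight (R : realType) (G : sgraph) (i : 'I_3)
    (v : G * bool) : R :=
  (-1) ^+ v.2 * box_label R i v.1.

Definition box_exponent (i : 'I_3) : nat :=
  if i == 1 :> nat then 2%N else 1%N.

Lemma box_weight_swap (R : realType) (G : sgraph) i (v : G * bool) :
  box_weight R i (swap_copy v) = - box_weight R i v.
Proof. by rewrite /box_weight /= signrN mulNr. Qed.

Lemma sum_copies (V : nmodType) (T : finType) (F : T * bool -> V) :
  \sum_v F v = \sum_x F (x, false) + \sum_x F (x, true).
Proof.
rewrite (eq_bigr (fun v => F (v.1, v.2))); last by case.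
rewrite -(pair_bigA _ (fun x b => F (x, b))) exchange_big big_bool /=.
exact: addrC.
Qed.

Lemma box_power_sum_eq0 (R : realType) (G : sgraph) (w : G * bool -> R) i :
  \sum_v box_weight R i v * w v ^+ box_exponent i = 0 ->
  \sum_a box_label R i a * w (a, false) ^+ box_exponent i =
  \sum_a box_label R i a * w (a, true) ^+ box_exponent i.
Proof.
rewrite sum_copies /box_weight /=.
under eq_bigr do rewrite expr0 mul1r.
under [X in _ + X]eq_bigr do rewrite expr1 mulN1r mulNr.
by rewrite sumrN => /eqP; rewrite subr_eq0 => /eqP.
Qed.

(** A complete bipartite graph with two vertices on each side contains a
    4-cycle. *)
Lemma C4_free_box0 (G : sgraph) (A B : {set G}) :
  C4_free G -> box0_cond A B ->
  {in A &, forall x y, x = y} \/ {in B &, forall x y, x = y}.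
Proof.
move=> G4 /andP[_ /forall_inP AB].
have adjAB a b : a \in A -> b \in B -> adj a b by move=> /AB/forall_inP; exact.
have [AA|] := pselect {in A &, forall x y, x = y}; first by left.
move=> /existsNP[u /existsNP[v /not_implyP[uA /not_implyP[vA /eqP uv]]]].
by right=> x y xB yB; apply: (G4 u v); rewrite ?adjAB.
Qed.

(** Where the masses of the two copies agree, both sides of the supporting face
    are nonempty and one is a single vertex; equality of the sums of squares
    makes the other side a single vertex as well, and the numbering tells these
    two vertices apart. *)
Lemma box0_power_sums_neq0 (R : realType) (G : sgraph) (w : G * bool -> R) :
    C4_free G -> (forall v, 0 <= w v) -> \sum_v w v = 1 ->
    [set v | w v != 0]%SET \in box0_faces G ->
  exists i, \sum_v box_weight R i v * w v ^+ box_exponent i != 0.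
Proof.
move=> G4 w0 w1 /imset2P[A B _]; rewrite inE => cAB supp.
pose u b a := w (a, b); have u0 b a : 0 <= u b a by exact: w0.
have suppA a : (a \in A) = (u false a != 0).
  by have /setP/(_ (a, false)) := supp; rewrite mem_biplus !inE.
have suppB a : (a \in B) = (u true a != 0).
  by have /setP/(_ (a, true)) := supp; rewrite mem_biplus !inE.
apply: contrapT => /forallNP all0.
have H i : \sum_v box_weight R i v * w v ^+ box_exponent i = 0.
  by apply/eqP; apply: contrapT => /negP; exact: all0.
pose s := \sum_a u false a.
have sE b : \sum_a u b a = s.
  case: b => //; move/box_power_sum_eq0: (H ord0); rewrite /box_label /=.
  by under eq_bigr do rewrite mul1r; under [RHS]eq_bigr do rewrite mul1r.
have sn0 : s != 0.
  move: w1; rewrite sum_copies [X in X + _](sE false) [X in _ + X](sE true).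
  by move=> ss; apply: contra_eq_neq ss => ->; rewrite addr0 eq_sym oner_eq0.
have sqrE : \sum_a u false a ^+ 2 = \sum_a u true a ^+ 2.
  move/box_power_sum_eq0: (H (inord 1)).
  rewrite /box_exponent /box_label inordK //=.
  by under eq_bigr do rewrite mul1r; under [RHS]eq_bigr do rewrite mul1r.
have rankE : \sum_a (enum_rank a)%:R * u false a
    = \sum_a (enum_rank a)%:R * u true a :> R.
  move/box_power_sum_eq0: (H (inord 2)).
  by rewrite /box_exponent /box_label inordK.
have conc b : \sum_a u b a ^+ 2 = s ^+ 2 <-> concentrated (u b).
  by rewrite -(sE b); apply: concentratedP; rewrite ?sE.
have one b : {in [pred a | u b a != 0] &, forall x y, x = y} ->
    concentrated (u b).
  by apply: concentrated_support; rewrite sE.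
have cA : concentrated (u false).
  have [AA|BB] := C4_free_box0 G4 cAB.
    by apply: one => x y; rewrite !inE -!suppA; exact: AA.
  apply/conc; rewrite sqrE; apply/conc/one => x y.
  by rewrite !inE -!suppB; exact: BB.
have cB : concentrated (u true) by apply/conc; rewrite -sqrE; exact/conc.
case: cA cB => a0 ua [b0 ub].
have {}ua a : u false a = s *+ (a == a0) by rewrite ua sE.
have {}ub b : u true b = s *+ (b == b0) by rewrite ub sE.
have rank_sum b c : (forall a, u b a = s *+ (a == c)) ->
    \sum_a (enum_rank a)%:R * u b a = (enum_rank c)%:R * s.
  move=> ubc; rewrite (bigD1 c) //= big1 ?addr0 => [|a /negPf ac].
    by rewrite ubc eqxx.
  by rewrite ubc ac mulr0n mulr0.
have : a0 = b0.
  move: rankE; rewrite (rank_sum _ _ ua) (rank_sum _ _ ub) => /(mulIf sn0)/eqP.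
  by rewrite eqr_nat => /eqP/val_inj/enum_rank_inj.
have a0A : a0 \in A by rewrite suppA ua eqxx.
have b0B : b0 \in B by rewrite suppB ub eqxx.
have /andP[dAB _] : box0_cond A B by [].
by move=> ab; have := disjointFr dAB a0A; rewrite ab b0B.
Qed.

Lemma C4_free_box0_z2map (R : realType) (G : sgraph) : C4_free G ->
  exists f : realization R (box_complex0 G) -> sphere R 2, z2map f.
Proof.
move=> G4; apply: (power_sums_z2map (K := box_complex0 G) (a := @box_weight R G)
  (p := box_exponent)).
  exact: box_weight_swap.
by move=> w; rewrite inE => -[w0 w1 wK]; exact: box0_power_sums_neq0.
Qed.

Lemma box_sub_box0 (G : sgraph) : box_faces G \subset box0_faces G.
Proof.
apply/fintype.subsetP => s /imset2P[A B _]; rewrite inE => sAB ->.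
have /and3P[cAB _ _] : box_cond A B := sAB.
by apply/imset2P; exists A B => //; rewrite inE; exact: cAB.
Qed.

Lemma C4_free_box_z2map (R : realType) (G : sgraph) : C4_free G ->
  exists f : realization R (box_complex G) -> sphere R 2, z2map f.
Proof.
move=> G4; apply: (power_sums_z2map (K := box_complex G) (a := @box_weight R G)
  (p := box_exponent)).
  exact: box_weight_swap.
move=> w; rewrite inE => -[w0 w1 wK]; apply: box0_power_sums_neq0 => //.
exact: fintype.subsetP (box_sub_box0 G) _ wK.
Qed.

Local Close Scope ring_scope.

Theorem mainTheorem5 (R : realType) (k : nat) :
  exists G : sgraph, connected_graph G /\
    exists ind ind0 : nat,
      [/\ is_z2index R (realization R (box_complex G)) ind,
          is_z2index R (realization R (box_complex0 G)) ind0,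
          (ind + 2 + k <= chromatic_number G)%N &
          (ind0 + 1 + k <= chromatic_number G)%N].
Proof.
have [H H4 Hk] := C4_free_not_colorable (k + 3).
have G4 := subdivided_cone_C4_free H4.
have chi := ltn_chromatic_number (subdivided_cone_not_colorable Hk).
have [i Xi i2] := is_z2index_exists (C4_free_box_z2map R G4).
have [i0 Xi0 i02] := is_z2index_exists (C4_free_box0_z2map R G4).
exists (subdivided_cone H); split; first exact: subdivided_cone_connected.
exists i, i0; split=> //; apply: leq_trans chi; rewrite -addnA (addnC _ k).
  by rewrite (addnC i) -addnA -addnS leq_add2l.
by rewrite (addnC i0) -addnA -addnS leq_add2l (leq_trans _ (_ : 3 <= 4)).
Qed.
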